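(* Suppose there exist a constant $\eta\ge1$ and a function $\sigma^2(\cdot)\ge0$ such that for any $y\in\Omega$ (and every inner sample size $m$), $\mathrm{Var}(\hat g_m(y))\le\sigma^2(y)/m^\eta$. Let $\sigma(\omega)$ be the square root of $\sigma^2(\omega)$. Assume that the random variable $|g(\omega)-c|/\sigma(\omega)$ has a density $\rho(\cdot)$, and that there exist constants $\rho_0>0$ and $x_0>0$ such that $\rho(x)\le\rho_0$ for all $x\in[0,x_0]$. Let $P=\mathbb{I}\{g(\omega)>c\}$ and $P_\ell=\mathbb{I}\{\hat g_{m_\ell}(\omega)>c\}$ with $m_\ell=2^{\ell+\ell_0}$. Then, as $\ell\to\infty$, $$\mathrm{Var}(P_\ell-P)\le\mathbb{E}[(P_\ell-P)^2]=O(m_\ell^{-\eta/2}).$$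
   Context: $\omega$ is a multidimensional random variable with set of possible scenarios $\Omega$, $X$ is a one-dimensional random variable, $g(\omega)=\mathbb{E}[X\mid\omega]$, and $c$ is a given real constant. Given $\omega=y\in\Omega$, $X$ is generated as $X(y)=\psi(\boldsymbol u;y)$ with $\boldsymbol u$ uniform on $[0,1)^d$, so that $g(y)=\int_{[0,1)^d}\psi(\boldsymbol u;y)\,d\boldsymbol u$. For a sample size $m$, the inner estimator is $\hat g_m(y)=\frac1m\sum_{j=1}^m\psi(\boldsymbol u_j;y)$, where $\boldsymbol u_1,\dots,\boldsymbol u_m$ are either i.i.d. uniform points on $[0,1)^d$ (Monte Carlo) or randomized quasi-Monte Carlo points, the randomness of the points being independent of $\omega$; in both settings $\mathbb{E}[\hat g_m(y)]=g(y)$ for all $y$. The variance $\mathrm{Var}(\hat g_m(y))$ is taken over the random points for fixed $y$. Here $\ell_0\ge0$ is a fixed integer, $\ell=0,1,2,\dots$ is the level, and $\mathbb{I}$ denotes the indicator function. *)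

(* Defs.v *)
From HB Require Import structures.
From mathcomp Require Import all_boot all_order all_algebra.
From mathcomp Require Import all_classical all_reals all_analysis.

Set Implicit Arguments.
Unset Strict Implicit.
Unset Printing Implicit Defensive.

Import Order.TTheory GRing.Theory Num.Theory.
Import numFieldNormedType.Exports.

Local Open Scope classical_set_scope.
Local Open Scope ring_scope.

Section uniform_cube.
Context (R : realType).

Definition unit_cube (d : nat) : set (d.-tuple R) :=
  [set u | forall i, 0 <= tnth u i < 1].

Lemma measurable_unit_cube (d : nat) : measurable (@unit_cube d).
Proof.
rewrite (_ : @unit_cube d = \bigcap_(i in [set: 'I_d])
    ((fun u : d.-tuple R => tnth u i) @^-1` `[0, 1[%classic)).
  apply: fin_bigcap_measurable => // i _.
  by rewrite -[X in measurable X]setTI; exact: measurable_tnth.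
by apply/seteqP; split=> u /= h i; move: (h i); rewrite /= in_itv/= => // /(_ I).
Qed.

(* The library's laws on the real line live on the alias measurableTypeR R of R,
   which carries the same Borel sets. *)
Definition tuple_cons (n : nat) (p : measurableTypeR R * n.-tuple R)
    : n.+1.-tuple R :=
  [tuple of (p.1 : R) :: p.2].

Lemma measurable_tuple_cons (n : nat) :
  measurable_fun [set: measurableTypeR R * n.-tuple R] (@tuple_cons n).
Proof.
apply: (@measurable_cons _ _ _ R (fun p : measurableTypeR R * n.-tuple R => p.1)).
- exact: measurable_fst.
- exact: measurable_snd.
Qed.

HB.instance Definition _ (n : nat) :=
  isMeasurableFun.Build _ _ _ _ (@tuple_cons n) (@measurable_tuple_cons n).

(* The d-fold product of the uniform law on [0, 1]. The closed faces are null,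
   so this is Lebesgue measure on [0, 1)^d, as a law on the whole of R^d. *)
Fixpoint uniform_cube (d : nat) : probability (d.-tuple R) R :=
  match d with
  | 0 => dirac [tuple]
  | n.+1 =>
      distribution (uniform_prob (@ltr01 R) \x uniform_cube n)%E (@tuple_cons n)
  end.

End uniform_cube.
Arguments unit_cube : clear implicits.

Section probability_notions.
Context (dT : measure_display) (T : measurableType dT) (R : realType).
Variable Pr : probability T R.

Definition independent_RV (d1 d2 : measure_display)
    (T1 : measurableType d1) (T2 : measurableType d2)
    (X : T -> T1) (Y : T -> T2) : Prop :=
  forall (A : set T1) (B : set T2), measurable A -> measurable B ->
    Pr (X @^-1` A `&` Y @^-1` B) = (Pr (X @^-1` A) * Pr (Y @^-1` B))%E.

Definition has_density (Z : T -> R) (rho : R -> R) : Prop :=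
  [/\ measurable_fun [set: T] Z,
      measurable_fun [set: R] rho,
      (forall x, 0 <= rho x) &
      forall A : set R, measurable A ->
        Pr (Z @^-1` A) = (\int[lebesgue_measure]_(x in A) (rho x)%:E)%E].

Definition iid_uniform (d m : nat) (U : T -> m.-tuple (d.-tuple R)) : Prop :=
  (forall (j : 'I_m) (B : set (d.-tuple R)), measurable B ->
     Pr [set t | B (tnth (U t) j)] = uniform_cube R d B) /\
  (forall B : 'I_m -> set (d.-tuple R), (forall j, measurable (B j)) ->
     Pr [set t | forall j, B j (tnth (U t) j)] =
     (\prod_(j < m) Pr [set t | B j (tnth (U t) j)])%E).

End probability_notions.

Section nested_simulation.
Context (R : realType) (d : nat) (Omega : Type).
Variable psi : d.-tuple R -> Omega -> R.

(* E[X | omega = y] for X generated as psi(u; y) with u uniform. *)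
Definition inner_mean (y : Omega) : R :=
  (\int[uniform_cube R d]_(u in unit_cube R d) psi u y)%R.

Definition inner_estimator (m : nat) (u : m.-tuple (d.-tuple R)) (y : Omega)
    : R :=
  m%:R^-1 * \sum_(j < m) psi (tnth u j) y.

(* What is required of randomized quasi-Monte Carlo points: any joint law of the
   m points is allowed (in particular they may be dependent) as long as the
   sample mean is unbiased at every scenario. The expectation is an extended
   real, so being equal to a real entails integrability. *)
Definition unbiased_points (dT : measure_display) (T : measurableType dT)
    (Pr : probability T R) (m : nat) (U : T -> m.-tuple (d.-tuple R)) : Prop :=
  forall y, ('E_Pr[fun t => inner_estimator (U t) y] = (inner_mean y)%:E)%E.

End nested_simulation.

(* Main.v *)
Require Import Defs.
From HB Require Import structures.
From mathcomp Require Import all_boot all_order all_algebra.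
From mathcomp Require Import all_classical all_reals all_analysis.
From mathcomp Require Import measurable_realfun ring lra.

Set Implicit Arguments.
Unset Strict Implicit.
Unset Printing Implicit Defensive.

Import Order.TTheory GRing.Theory Num.Theory.
Import numFieldNormedType.Exports.

Local Open Scope classical_set_scope.
Local Open Scope ring_scope.

(** Fix a sample size m and put a = m^(-eta/2).  The indicators of
    {ghat_m(omega) > c} and {g(omega) > c} differ on the event A that the
    estimator and the true inner mean lie on different sides of c, and
    E[(P_l - P)^2] = Pr(A).  Two ingredients bound Pr(A).

    Conditionally on omega = y, being on the wrong side of c forces the
    estimator to miss its mean g(y) by at least |g(y) - c|, so Chebyshev's
    inequality gives a conditional probability at most
    Var(ghat_m(y)) / |g(y) - c|^2 <= (a / z)^2, where z = |g(y) - c| / sigma(y)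
    ([misclassification_chebyshev]); it is at most 1 as well.  Conditioning is
    Fubini's theorem for the independent pair (omega, U)
    ([independent_RV_disintegration]).  As sigma is an arbitrary function of y,
    what gets integrated is the conditional probability itself, which is
    measurable in y; it is compared pointwise on the sample space with the
    random variable Z = |g(omega) - c| / sigma(omega).

    It remains to bound E[min(1, (a / Z)^2)].  The density bound near 0 gives
    Pr(Z <= s) <= C s for every s > 0 ([small_ball_of_density]).  Cutting
    Z > 0 into the dyadic layers Z ~ 2^k a, the k-th layer has probability
    O(C 2^k a) and carries an integrand O(4^(-k)), and the sum over k is a
    geometric series of size O(C a) ([truncated_second_moment_le]).  Hence
    Pr(A) = O(a) = O(m^(-eta/2)). *)

(** * Conditioning on one member of an independent pair *)

Section independence.
Context (R : realType) (dT : measure_display) (T : measurableType dT)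
  (Pr : probability T R).
Context (d1 d2 : measure_display) (T1 : measurableType d1)
  (T2 : measurableType d2).

(** Independence says that the joint law agrees with the product of the
    marginal laws on rectangles, hence everywhere; the product measure of [B]
    is by definition the integral of the measures of its sections. *)
Lemma independent_RV_disintegration (X : {RV Pr >-> T1}) (Y : {RV Pr >-> T2})
    (B : set (T1 * T2)) :
  independent_RV Pr X Y -> measurable B ->
  Pr [set t | B (X t, Y t)] = (\int[Pr]_t Pr [set s | B (X t, Y s)])%E.
Proof.
move=> XY mB.
have mXY : measurable_fun [set: T] (fun t => (X t, Y t)).
  by apply: measurable_fun_pair; exact: measurable_funPT.
pose XYm : {mfun T >-> (T1 * T2)%type} :=
  HB.pack (fun t => (X t, Y t)) (isMeasurableFun.Build _ _ _ _ _ mXY).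
have <- : distribution Pr XYm B = Pr [set t | B (X t, Y t)] by [].
have H A C : measurable A -> measurable C ->
    distribution Pr XYm (A `*` C)
    = (distribution Pr X A * distribution Pr Y C)%E.
  by move=> mA mC; exact: XY.
rewrite -(product_measure_unique H mB) /product_measure1 /=.
rewrite ge0_integral_distribution//.
- apply: eq_integral => t _ /=.
  rewrite /distribution /pushforward/=; congr (Pr _).
  by apply/seteqP; split=> s /=; rewrite /xsection/= in_setE.
- exact: measurable_fun_xsection.
Qed.

End independence.

(** * Truncated second moments under a small ball estimate *)

Lemma measurable_sublevel (R : realType) (d : measure_display)
    (T : measurableType d) (f : T -> R) (s : R) :
  measurable_fun [set: T] f -> measurable [set t | f t <= s].
Proof.
move=> mf; have := mf measurableT `]-oo, s]%classic (measurable_itv _).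
by rewrite setTI; congr measurable; apply/seteqP; split=> t /=; rewrite in_itv.
Qed.

Section truncated_second_moment.
Context (R : realType) (dT : measure_display) (T : measurableType dT)
  (Pr : probability T R).

(** A pointwise majorant of min(1, (a / z)^2) by a finite combination of the
    indicators of {z <= 2^k a}.  In the induction, the step from [n] to [n.+1]
    lowers the remainder by 3 * 4^-n; either z <= 2^n a and the new indicator
    pays for it, or z > 2^n a and (a / z)^2 <= 4^-n is already below the new
    remainder.  This is where the weights 3 and 4 come from. *)
Lemma dyadic_layers (a z q : R) (n : nat) : 0 < a -> q <= 1 ->
  (a < z -> q <= (a / z) ^+ 2) ->
  q <= 4 * 4^-1 ^+ n
       + \sum_(k < n) 3 * 4^-1 ^+ k * ((z <= 2 ^+ k * a)%R%:R : R).
Proof.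
move=> a0 q1 qz; elim: n => [|n IH]; first by rewrite big_ord0 expr0; lra.
have p0 : 0 < 4^-1 ^+ n :> R by rewrite exprn_gt0.
rewrite big_ord_recr/= exprS.
have [zle|zgt] := leP z (2 ^+ n * a).
  by rewrite mulr1 [_ * (4^-1 * _)]mulrA; lra.
rewrite mulr0 addr0.
have za : a < z.
  apply: le_lt_trans zgt; rewrite ler_peMl//; first exact: ltW.
  by rewrite exprn_ege1// ler1n.
have z0 : 0 < z by exact: lt_trans za.
have : (a / z) ^+ 2 <= 4^-1 ^+ n.
  have -> : 4^-1 ^+ n = (2^-1 ^+ n) ^+ 2 :> R.
    by rewrite -exprM mulnC exprM; congr (_ ^+ n); rewrite expr2; field.
  rewrite ler_pXn2r// ?nnegrE ?exprn_ge0 ?divr_ge0 ?(ltW a0) ?(ltW z0)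
    ?invr_ge0//.
  by rewrite ler_pdivrMr// exprVn -ler_pdivrMl ?invrK ?ltW// invr_gt0 exprn_gt0.
have S0 : 0 <= \sum_(k < n) 3 * 4^-1 ^+ k * ((z <= 2 ^+ k * a)%R%:R : R).
  by apply: sumr_ge0 => k _; rewrite !mulr_ge0// exprn_ge0.
by have := qz za; lra.
Qed.

(** Integrating the dyadic majorant, the k-th term contributes at most
    3 * 4^-k * C * 2^k * a = 3 * C * a * 2^-k, so that the whole sum stays below
    6 * C * a whatever the number of layers, while the remainder 4 * 4^-n
    vanishes as the number n of layers grows.  Where Z <= a, including where
    Z = 0, the integrand is only known to be at most 1. *)
Lemma truncated_second_moment_le (Z : T -> R) (q : T -> \bar R) (C a : R) :
  measurable_fun [set: T] Z -> measurable_fun [set: T] q ->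
  (forall s, 0 < s -> (Pr [set t | (Z t <= s)%R] <= (C * s)%:E)%E) ->
  0 < a ->
  (forall t, 0 <= q t)%E -> (forall t, q t <= 1)%E ->
  (forall t, (a < Z t)%R -> (q t <= ((a / Z t) ^+ 2)%:E)%E) ->
  (\int[Pr]_t q t <= (6 * C * a)%:E)%E.
Proof.
move=> mZ mq PZ a0 q0 q1 qZ.
have mA s : measurable [set t | (Z t <= s)%R].
  exact: measurable_sublevel.
have C0 : 0 <= C.
  by have := le_trans (measure_ge0 _ _) (PZ _ ltr01); rewrite lee_fin mulr1.
pose A k := [set t | (Z t <= 2 ^+ k * a)%R].
pose S n t : \bar R := ((4 * 4^-1 ^+ n)%:E
  + \sum_(k <- index_enum 'I_n) (3 * 4^-1 ^+ k)%:E * (\1_(A k) t)%:E)%E.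
have mI n (k : 'I_n) : measurable_fun [set: T]
    (fun t => ((3 * 4^-1 ^+ k)%:E * (\1_(A k) t)%:E : \bar R)%E).
  apply: emeasurable_funM; first exact: measurable_cst.
  by apply/measurable_EFinP; exact: (measurable_indic (mA _)).
have I0 n (k : 'I_n) t :
    (0 <= (3 * 4^-1 ^+ k)%:E * (\1_(A k) t)%:E :> \bar R)%E.
  by rewrite lee_fin !mulr_ge0// exprn_ge0.
have mS n : measurable_fun [set: T] (fun t : T => (\sum_(k <- index_enum 'I_n)
   (3 * 4^-1 ^+ k)%:E * (\1_(A k) t)%:E : \bar R)%E).
  exact: (emeasurable_sum _ (mI n)).
have qS n t : (q t <= S n t)%E.
  have qfin : (q t) \is a fin_num.
    by rewrite ge0_fin_numE// (le_lt_trans (q1 t))// ltry.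
  have -> : S n t = (4 * 4^-1 ^+ n
       + \sum_(k < n) 3 * 4^-1 ^+ k * ((Z t <= 2 ^+ k * a)%R%:R : R))%:E.
    rewrite EFinD -sumEFin; congr (_ + _)%E; apply: eq_bigr => k _.
    by rewrite indicE EFinM; congr (_ * (_%:R)%:E)%E;
      rewrite -(asboolb (_ <= _)) /in_mem/=.
  rewrite -(fineK qfin) lee_fin; apply: dyadic_layers => //.
    by have := q1 t; rewrite -{1}(fineK qfin) lee_fin.
  by move=> aZ; have := qZ t aZ; rewrite -{1}(fineK qfin) lee_fin.
have Sn n : (\int[Pr]_t q t <= (4 * 4^-1 ^+ n + 6 * C * a)%:E)%E.
  apply: (@le_trans _ _ (\int[Pr]_t S n t)%E).
    apply: ge0_le_integral => //.
    by apply: emeasurable_funD => //; exact: measurable_cst.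
  rewrite /S ge0_integralD//; last by move=> t _; exact: sume_ge0.
  rewrite (integral_cst Pr measurableT (4 * 4^-1 ^+ n)%:E)
    [X in (_ * X)%E]probability_setT mule1 EFinD leeD2l//.
  rewrite ge0_integral_sum//.
  apply: (@le_trans _ _ (\sum_(k < n) (3 * C * a * 2^-1 ^+ k)%:E)%E).
    apply: lee_sum => k _.
    rewrite ge0_integralZl_EFin//; last first.
      by apply/measurable_EFinP; exact: (measurable_indic (mA _)).
    rewrite (integral_indic _ measurableT (mA _)) setIT.
    have p0 : 0 < 2 ^+ k :> R by rewrite exprn_gt0.
    apply: (@le_trans _ _ ((3 * 4^-1 ^+ k)%:E * (C * (2 ^+ k * a))%:E)%E).
      by rewrite lee_pmul2l// ?lte_fin ?mulr_gt0 ?exprn_gt0//; apply: PZ;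
        rewrite mulr_gt0.
    rewrite -EFinM lee_fin.
    have -> : 4^-1 ^+ k = (2 ^+ k)^-1 * (2 ^+ k)^-1 :> R.
      by rewrite -invfM -exprMn exprVn; congr (_ ^+ k)^-1; ring.
    rewrite exprVn le_eqVlt; apply/orP; left; apply/eqP; field.
    by rewrite gt_eqF.
  rewrite sumEFin lee_fin -mulr_sumr.
  have -> : \sum_(k < n) 2^-1 ^+ k = 2 - 2 * 2^-1 ^+ n :> R.
    elim: n {mI I0 mS qS} => [|n IH]; first by rewrite big_ord0 expr0; lra.
    by rewrite big_ord_recr/= IH exprS; field.
  have v0 : 0 <= 2^-1 ^+ n :> R by rewrite exprn_ge0.
  by have := mulr_ge0 (mulr_ge0 C0 (ltW a0)) v0; lra.
apply/lee_addgt0Pr => e e0.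
have [n ne] : exists n, 4 * 4^-1 ^+ n <= e :> R.
  have : (fun n => 4 * 4^-1 ^+ n : R) @ \oo --> (0 : R).
    by rewrite -[X in _ --> X](mulr0 4); apply: cvgMr; apply: cvg_expr;
      rewrite ger0_norm// invf_lt1// ltr1n.
  move=> /cvgr0_norm_lt/(_ _ e0)[n _ /(_ n (leqnn n))] /=.
  by move=> /ltW ne; exists n; apply: le_trans ne; exact: ler_norm.
apply: le_trans (Sn n) _.
by rewrite -EFinD lee_fin addrC lerD2l.
Qed.

(** For s <= x0 the density is below [rho0] on [0, s]; for s > x0 the term
    x0^-1 * s exceeds 1, so a single linear bound serves all radii. *)
Lemma small_ball_of_density (Z : T -> R) (rho : R -> R) (rho0 x0 : R) :
  (forall t, 0 <= Z t) -> has_density Pr Z rho -> 0 < x0 ->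
  0 <= rho0 ->
  (forall x, 0 <= x <= x0 -> rho x <= rho0) ->
  forall s, 0 < s ->
    (Pr [set t | (Z t <= s)%R] <= ((rho0 + x0^-1) * s)%:E)%E.
Proof.
move=> Z0 [mZ mrho rho_ge0 Zrho] x00 rho00 rhole s s0.
have [sx|xs] := leP s x0; last first.
  apply: le_trans (probability_le1 _ (measurable_sublevel s mZ)) _.
  rewrite lee_fin mulrDl.
  have : 1 <= x0^-1 * s by rewrite mulrC ler_pdivlMr// mul1r ltW.
  by have := mulr_ge0 rho00 (ltW s0); lra.
have -> : [set t | (Z t <= s)%R] = Z @^-1` `[0, s]%classic.
  by apply/seteqP; split=> t /=; rewrite in_itv/= Z0.
rewrite Zrho//.
apply: (@le_trans _ _
  (\int[lebesgue_measure]_(x in `[0%R, s]) cst rho0%:E x)%E).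
  apply: ge0_le_integral => //.
  - by move=> x _; rewrite lee_fin.
  - by apply/measurable_EFinP; exact: measurable_funTS.
  - move=> x /=; rewrite in_itv/= => /andP[x_ge0 xs].
    by rewrite lee_fin rhole// x_ge0 (le_trans xs).
rewrite integral_cst//= lebesgue_measure_itv/= lte_fin s0 sube0 -EFinM lee_fin.
by rewrite mulrDl lerDl mulr_ge0 ?invr_ge0// ltW.
Qed.

End truncated_second_moment.

(** * Second moments, indicators and Chebyshev's inequality *)

Lemma measurable_neq_bool (d : measure_display) (T : measurableType d)
    (f g : T -> bool) :
  measurable_fun [set: T] f -> measurable_fun [set: T] g ->
  measurable [set t | f t != g t].
Proof.
move=> mf mg.
have mF := mf measurableT [set true] I; have mG := mg measurableT [set true] I.
rewrite !setTI in mF mG.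
have -> : [set t | f t != g t] =
    (f @^-1` [set true] `\` g @^-1` [set true]) `|`
    (g @^-1` [set true] `\` f @^-1` [set true]).
  by apply/seteqP; split=> t /=; case: (f t); case: (g t) => //=;
    intuition congruence.
by apply: measurableU; exact: measurableD.
Qed.

Section moments.
Context (R : realType) (dT : measure_display) (T : measurableType dT)
  (Pr : probability T R).

Lemma Lfun2_bounded (X : T -> R) (M : R) : measurable_fun [set: T] X ->
  (forall t, `|X t| <= M) -> X \in Lfun Pr 2%:E.
Proof.
move=> mX XM; rewrite inE; apply/andP; split; rewrite inE//= /finite_norm.
apply: (@lty_poweRy _ _ 2) => //.
rewrite poweR_Lnorm//.
apply: (@le_lt_trans _ _ (\int[Pr]_t cst (M `^ 2)%:E t)%E).
  apply: ge0_le_integral => //.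
  - by move=> t _; exact: poweR_ge0.
  - apply/measurable_EFinP.
    apply: (@measurableT_comp _ _ _ _ _ _ (@powR R ^~ 2)).
      exact: measurable_powR.
    exact: measurableT_comp.
  - move=> t _ /=; rewrite lee_fin ge0_ler_powR ?nnegrE//.
    exact: le_trans (XM t).
rewrite integral_cst//= [X in (_ * X)%E]probability_setT mule1.
exact: ltry.
Qed.

Lemma variance_le_second_moment (X : T -> R) : X \in Lfun Pr 2%:E ->
  ('V_Pr[X] <= 'E_Pr[fun t => (X t ^+ 2)%R])%E.
Proof.
move=> X2; rewrite varianceE//.
have EX : ('E_Pr[X])%E \is a fin_num.
  by rewrite expectation_fin_num// Lfun_subset12// fin_num_measure.
rewrite -(fineK EX) -EFin_expe -[leRHS]adde0 leeD2l// leeNl oppe0 lee_fin.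
exact: sqr_ge0.
Qed.

Lemma expectation_sqr_indicB (A B : set T) : measurable A -> measurable B ->
  ('E_Pr[fun t => ((\1_A t - \1_B t) ^+ 2)%R]
   = Pr [set t | (t \in A) != (t \in B)])%E.
Proof.
move=> mA mB.
have mem D : measurable D -> measurable_fun [set: T] (fun t => t \in D).
  by move=> mD; apply: (measurable_fun_bool true);
    rewrite setTI preimage_mem_true.
rewrite -expectation_indic; last by apply: measurable_neq_bool; exact: mem.
congr ('E_Pr[_])%E; apply/funext => t; rewrite !indicE.
rewrite (_ : (t \in [set _ | _]) = ((t \in A) != (t \in B))); last first.
  by apply/idP/idP => [/set_mem//|?]; exact: mem_set.
by case: (t \in A); case: (t \in B) => /=;
  rewrite ?subrr ?subr0 ?sub0r ?sqrrN ?expr0n ?expr1n.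
Qed.

(** If [X] and its mean [mu] are on different sides of [c], then [c] lies
    between them and |X - mu| >= |mu - c|: Chebyshev's inequality applies with
    the radius |mu - c|. *)
Lemma misclassification_chebyshev (X : {RV Pr >-> R}) (mu c : R) :
  ('E_Pr[X] = mu%:E)%E -> mu != c ->
  (Pr [set s | ((c < X s)%R != (c < mu)%R)]
     <= (`|mu - c| ^- 2)%:E * 'V_Pr[X])%E.
Proof.
move=> EX muc.
have gap0 : 0 < `|mu - c| by rewrite normr_gt0 subr_eq0.
have mX := measurable_funPT X.
have mc : measurable_fun [set: T] (fun s => c < X s).
  by apply: measurable_fun_ltr => //; exact: measurable_cst.
apply: le_trans (chebyshev X gap0); apply: le_measure; rewrite ?inE.
- by apply: measurable_neq_bool => //; exact: measurable_cst.
- have mD : measurable_fun [set: T] (fun s => `|X s - fine ('E_Pr[X])%E|).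
    by apply: measurableT_comp => //; apply: measurable_funB => //;
      exact: measurable_cst.
  have := mD measurableT `[`|mu - c|, +oo[%classic (measurable_itv _).
  by rewrite setTI; congr measurable; apply/seteqP; split=> s /=;
    rewrite in_itv/= andbT.
- move=> s /=; rewrite EX /=.
  case: (ltP c (X s)) => cX; case: (ltP c mu) => cmu //= _.
    rewrite ler0_norm ?subr_le0// ger0_norm ?subr_ge0; last by lra.
    lra.
  rewrite ger0_norm ?subr_ge0 ?(ltW cmu)// ler0_norm; lra.
Qed.

Lemma integral_law (d1 : measure_display) (T1 : measurableType d1)
    (X : {RV Pr >-> T1}) (mu : probability T1 R) (f : T1 -> \bar R) :
  (forall B, measurable B -> Pr (X @^-1` B) = mu B) ->
  mu.-integrable [set: T1] f ->
  Pr.-integrable [set: T] (f \o X) /\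
  (\int[Pr]_t f (X t) = \int[mu]_u f u)%E.
Proof.
move=> Xmu fint.
have E h : (\int[distribution Pr X]_u h u = \int[mu]_u h u)%E.
  by apply: eq_measure_integral => B mB _; exact: Xmu.
have mf := measurable_int _ fint.
have fX : Pr.-integrable [set: T] (f \o X).
  apply/integrableP; split.
    by apply: measurableT_comp => //; exact: measurable_funPT.
  have /integrableP[_] := fint; rewrite -E ge0_integral_distribution//.
  exact: measurableT_comp.
by split=> //; rewrite -E integral_distribution.
Qed.

End moments.

(** * Measurability and unbiasedness of the inner estimator *)

Section nested_estimator.
Context (R : realType) (dO : measure_display) (Omega : measurableType dO)
  (d : nat) (psi : d.-tuple R -> Omega -> R).

(** The integrand is measurable on the cube only; extending it by 0 gives a
    function measurable on the whole product, to which Fubini's theorem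
    applies, and changes neither the inner mean nor the estimator evaluated at
    points of the cube. *)
Definition extend0 : d.-tuple R * Omega -> R :=
  ((fun p : d.-tuple R * Omega => psi p.1 p.2) \_ (unit_cube R d `*` setT)).

Lemma extend0E u y : unit_cube R d u -> extend0 (u, y) = psi u y.
Proof. by move=> cu; rewrite /extend0 patchE mem_set. Qed.

Lemma measurable_extend0 :
  measurable_fun (unit_cube R d `*` [set: Omega])
    (fun p : d.-tuple R * Omega => psi p.1 p.2) ->
  measurable_fun [set: d.-tuple R * Omega] extend0.
Proof.
have mD := measurableX (@measurable_unit_cube R d) (@measurableT _ Omega).
by move=> mpsi; apply/(measurable_restrictT _ mD).
Qed.

Lemma inner_meanE y :
  inner_mean psi y = fine (\int[uniform_cube R d]_u (extend0 (u, y))%:E)%E.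
Proof.
rewrite /inner_mean /Rintegral integral_mkcond; congr fine.
apply: eq_integral => u _; rewrite /extend0 !patchE in_setX/= in_setT andbT.
by case: ifP.
Qed.

Lemma inner_estimatorE m (u : m.-tuple (d.-tuple R)) y :
  (forall j, unit_cube R d (tnth u j)) ->
  inner_estimator psi u y = inner_estimator (fun v z => extend0 (v, z)) u y.
Proof.
move=> cu; rewrite /inner_estimator; congr (_ * _).
by apply: eq_bigr => j _; rewrite extend0E.
Qed.

Context (mext : measurable_fun [set: d.-tuple R * Omega] extend0).

(** The integrand may fail to be jointly integrable, so measurability in the
    scenario is obtained separately for its positive and negative parts. *)
Lemma measurable_inner_mean : measurable_fun [set: Omega] (inner_mean psi).
Proof.
rewrite (_ : inner_mean psi = fun y =>
    fine (\int[uniform_cube R d]_u (EFin \o extend0)^\+%E (u, y)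
          - \int[uniform_cube R d]_u (EFin \o extend0)^\-%E (u, y))%E);
    last first.
  apply/funext => y; rewrite inner_meanE integralE.
  by congr (fine (_ - _)%E); apply: eq_integral => u _;
    rewrite ?funeposE ?funenegE.
have mE : measurable_fun [set: d.-tuple R * Omega] (EFin \o extend0).
  exact/measurable_EFinP.
apply: measurableT_comp => //; apply: emeasurable_funB.
- apply: (measurable_fun_fubini_tonelli_G (EFin \o extend0)^\+%E) => //.
  exact: measurable_funepos.
- apply: (measurable_fun_fubini_tonelli_G (EFin \o extend0)^\-%E) => //.
  exact: measurable_funeneg.
Qed.

Lemma measurable_inner_estimator m :
  measurable_fun [set: Omega * m.-tuple (d.-tuple R)]
    (fun p => inner_estimator (fun v z => extend0 (v, z)) p.2 p.1).
Proof.
rewrite /inner_estimator; apply: measurable_funM; first exact: measurable_cst.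
apply: measurable_sum => j.
apply: (measurableT_comp mext); apply: measurable_fun_pair => //.
exact: (measurableT_comp (measurable_tnth j) measurable_snd).
Qed.

Lemma measurable_misclassified m (c : R) :
  measurable [set p : Omega * m.-tuple (d.-tuple R) |
    (c < inner_estimator (fun v z => extend0 (v, z)) p.2 p.1)%R
      != (c < inner_mean psi p.1)%R].
Proof.
have mE : measurable_fun [set: Omega * m.-tuple (d.-tuple R)] (fun p =>
    c < inner_estimator (fun v z => extend0 (v, z)) p.2 p.1).
  by apply: measurable_fun_ltr; [exact: measurable_cst|
    exact: measurable_inner_estimator].
have mG : measurable_fun [set: Omega * m.-tuple (d.-tuple R)] (fun p =>
    c < inner_mean psi p.1).
  apply: measurable_fun_ltr; first exact: measurable_cst.
  by apply: measurableT_comp; [exact: measurable_inner_mean|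
    exact: measurable_fst].
exact: measurable_neq_bool.
Qed.

Context (dT : measure_display) (T : measurableType dT) (Pr : probability T R).

(** By linearity: each point has the uniform law, so that each of the [m]
    summands integrates to the inner mean. *)
Lemma iid_uniform_unbiased m (U : {RV Pr >-> m.-tuple (d.-tuple R)}) :
  (0 < m)%N -> (forall t j, unit_cube R d (tnth (U t) j)) ->
  (forall y, (uniform_cube R d).-integrable (unit_cube R d)
     (fun u => (psi u y)%:E)) ->
  iid_uniform Pr U -> unbiased_points psi Pr U.
Proof.
move=> m0 Ucube psi_int [Ulaw _] y.
have fint : (uniform_cube R d).-integrable [set: d.-tuple R]
    (fun u => (extend0 (u, y))%:E).
  have /(integrable_mkcond _ (@measurable_unit_cube R d)) := psi_int y.
  apply: eq_integrable => // u _;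
    rewrite /extend0 !patchE in_setX/= in_setT andbT.
  by case: ifP.
have mU (j : 'I_m) : measurable_fun [set: T] (fun t => tnth (U t) j).
  exact: (measurableT_comp (measurable_tnth j)
    (measurable_funPT (U : {mfun T >-> _}))).
pose Uj j : {RV Pr >-> d.-tuple R} :=
  HB.pack (fun t => tnth (U t) j) (isMeasurableFun.Build _ _ _ _ _ (mU j)).
have H j : Pr.-integrable [set: T] (fun t => (extend0 (tnth (U t) j, y))%:E) /\
   (\int[Pr]_t (extend0 (tnth (U t) j, y))%:E = (inner_mean psi y)%:E)%E.
  have [fi ->] :=
    @integral_law _ _ _ Pr _ _ (Uj j) (uniform_cube R d) _ (Ulaw j) fint.
  by split=> //; rewrite inner_meanE fineK// integrable_fin_num.
rewrite unlock.
under eq_integral do rewrite inner_estimatorE// /inner_estimator EFinM -sumEFin.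
rewrite integralZl//; last by apply: integrable_sum => // j _; have [] := H j.
rewrite integral_sum//; last by move=> j; have [] := H j.
under eq_bigr do rewrite (H _).2.
rewrite sumEFin sumr_const card_ord -EFinM; congr EFin.
by rewrite -(mulr_natl (inner_mean psi y)) mulrA mulVf ?mul1r// pnatr_eq0 -lt0n.
Qed.

End nested_estimator.

(** * The rate of convergence *)

Theorem theorem2p5 (R : realType)
  (dT : measure_display) (T : measurableType dT) (Pr : probability T R)
  (dO : measure_display) (Omega : measurableType dO)
  (omega : {RV Pr >-> Omega})
  (d : nat) (psi : d.-tuple R -> Omega -> R)
  (psi_meas : measurable_fun (unit_cube R d `*` [set: Omega])
     (fun p : d.-tuple R * Omega => psi p.1 p.2))
  (psi_int : forall y, (uniform_cube R d).-integrable (unit_cube R d)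
     (fun u => (psi u y)%:E))
  (U : forall m : nat, {RV Pr >-> m.-tuple (d.-tuple R)})
  (U_cube : forall m t j, unit_cube R d (tnth (U m t) j))
  (U_indep : forall m, independent_RV Pr omega (U m))
  (* Monte Carlo, or randomized quasi-Monte Carlo. *)
  (U_points : (forall m, (0 < m)%N -> iid_uniform Pr (U m)) \/
     (forall m, (0 < m)%N -> unbiased_points psi Pr (U m)))
  (c eta : R) (sigma2 : Omega -> R)
  (eta_ge1 : 1 <= eta)
  (sigma2_ge0 : forall y, 0 <= sigma2 y)
  (var_bound : forall y m, (0 < m)%N ->
     ('V_Pr[fun t => inner_estimator psi (U m t) y]
        <= (sigma2 y / m%:R `^ eta)%:E)%E)
  (rho : R -> R)
  (* Division by zero yields 0, so a density forces sigma(omega) > 0 a.s. *)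
  (rho_density : has_density Pr
     (fun t => `|inner_mean psi (omega t) - c| / Num.sqrt (sigma2 (omega t)))
     rho)
  (rho0 x0 : R) (rho0_gt0 : 0 < rho0) (x0_gt0 : 0 < x0)
  (rho_bound : forall x, 0 <= x <= x0 -> rho x <= rho0)
  (l0 : nat) :
  let m_ (l : nat) := (2 ^ (l + l0))%N in
  let P : T -> R := \1_[set t | c < inner_mean psi (omega t)] in
  let P_ (l : nat) : T -> R :=
    \1_[set t | c < inner_estimator psi (U (m_ l) t) (omega t)] in
  (forall l, ('V_Pr[fun t => (P_ l t - P t)%R]
                <= 'E_Pr[fun t => ((P_ l t - P t) ^+ 2)%R])%E) /\
  ((fun l => fine ('E_Pr[fun t => ((P_ l t - P t) ^+ 2)%R])%E : R^o)
     =O_\oo (fun l => (m_ l)%:R `^ (- (eta / 2)) : R^o)).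
Proof.
move=> m_ P P_.
have m_gt0 l : (0 < m_ l)%N by rewrite expn_gt0.
have mext := measurable_extend0 psi_meas.
pose est m := inner_estimator (m := m) (fun v z => extend0 psi (v, z)).
have estE m t y : inner_estimator psi (U m t) y = est m (U m t) y.
  exact: inner_estimatorE.
have mest m y : measurable_fun [set: T]
    (fun t => inner_estimator psi (U m t) y).
  under eq_fun do rewrite estE.
  apply: (measurableT_comp
    (measurable_fun_pair2 y (measurable_inner_estimator mext (m := m)))).
  exact: measurable_funPT.
pose est_RV m y : {RV Pr >-> R} :=
  HB.pack (fun t => inner_estimator psi (U m t) y)
    (isMeasurableFun.Build _ _ _ _ _ (mest m y)).
have unbiased m y : (0 < m)%N -> ('E_Pr[est_RV m y] = (inner_mean psi y)%:E)%E.
  move=> m0; case: U_points => [iid|]; last exact.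
  exact: (iid_uniform_unbiased m0 (@U_cube m) psi_int (iid m m0) y).
pose Z t := `|inner_mean psi (omega t) - c| / Num.sqrt (sigma2 (omega t)).
have Z_ge0 t : 0 <= Z t by rewrite divr_ge0.
pose A l := [set t | (c < inner_estimator psi (U (m_ l) t) (omega t))
                      != (c < inner_mean psi (omega t))].
pose C := rho0 + x0^-1.
have C0 : 0 < C by rewrite addr_gt0// invr_gt0.
pose a l := (m_ l)%:R `^ (- (eta / 2)) : R.
have ml0 l : 0 < (m_ l)%:R :> R by rewrite ltr0n.
have a_gt0 l : 0 < a l by rewrite powR_gt0.
have mT1 l : measurable_fun [set: T]
    (fun t => inner_estimator psi (U (m_ l) t) (omega t)).
  under eq_fun do rewrite estE.
  apply: (measurableT_comp (measurable_inner_estimator mext (m := m_ l))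
    (g := fun t => (omega t, U (m_ l) t))).
  by apply: measurable_fun_pair; exact: measurable_funPT.
have mT2 : measurable_fun [set: T] (fun t => inner_mean psi (omega t)).
  by apply: (measurableT_comp (measurable_inner_mean mext));
    exact: measurable_funPT.
have mltc (f : T -> R) :
    measurable_fun [set: T] f -> measurable [set t | c < f t].
  move=> mf; have := mf measurableT `]c, +oo[%classic (measurable_itv _).
  by rewrite setTI; congr measurable; apply/seteqP; split=> t /=;
    rewrite in_itv/= andbT.
have PrA l : (Pr (A l) <= (6 * C * a l)%:E)%E.
  pose B := [set p : Omega * (m_ l).-tuple (d.-tuple R) |
    (c < est (m_ l) p.2 p.1)%R != (c < inner_mean psi p.1)%R].
  have mB : measurable B by exact: measurable_misclassified.
  have -> : A l = [set t | B (omega t, U (m_ l) t)].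
    by apply/seteqP; split=> t; rewrite /A /B /= estE.
  (* Condition on omega, then compare with the truncated second moment of Z. *)
  rewrite (independent_RV_disintegration (U_indep (m_ l)) mB).
  apply: (truncated_second_moment_le (Z := Z)) => //.
  - by case: rho_density.
  - apply: (@measurableT_comp _ _ _ _ _ _
        (fun y => Pr [set s | B (y, U (m_ l) s)]) _ omega);
      last exact: measurable_funPT.
    apply: eq_measurable_fun
      (measurable_fun_xsection (distribution Pr (U (m_ l))) mB).
    move=> y _ /=; rewrite /distribution /pushforward/=; congr (Pr _).
    by apply/seteqP; split=> s /=; rewrite /xsection/= in_setE.
  - exact: (small_ball_of_density Z_ge0 rho_density x0_gt0 (ltW rho0_gt0)
      rho_bound).
  - move=> t; apply: probability_le1.
    have := measurable_xsection (omega t) mB => mX.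
    have := measurable_funPT (U (m_ l)) measurableT _ mX.
    by rewrite setTI; congr measurable; apply/seteqP; split=> s /=;
      rewrite /xsection/= in_setE.
  (* Z t > a > 0 excludes both g = c and sigma = 0, so that Chebyshev's bound
     applies; with the assumed bound on the variance it reads (a / Z t)^2. *)
  - move=> t aZ.
    set y := omega t.
    have Z0 : 0 < Z t by exact: lt_trans aZ.
    have gc : inner_mean psi y != c.
      by apply/eqP => gc; move: Z0; rewrite /Z -/y gc subrr normr0 mul0r ltxx.
    have s0 : 0 < Num.sqrt (sigma2 y).
      rewrite lt_neqAle sqrtr_ge0 andbT eq_sym; apply/eqP => s0.
      by move: Z0; rewrite /Z -/y s0 invr0 mulr0 ltxx.
    have := misclassification_chebyshev (unbiased (m_ l) y (m_gt0 l)) gc.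
    have -> : [set s | B (y, U (m_ l) s)]
       = [set s | (c < est_RV (m_ l) y s) != (c < inner_mean psi y)].
      by apply/seteqP; split=> s; rewrite /B /= estE.
    move=> /le_trans; apply.
    apply: (@le_trans _ _
      ((`|inner_mean psi y - c| ^- 2)%:E * (sigma2 y / (m_ l)%:R `^ eta)%:E)%E).
      by rewrite lee_pmul2l ?lte_fin ?invr_gt0 ?exprn_gt0 ?normr_gt0
           ?subr_eq0//; exact: var_bound.
    rewrite -EFinM lee_fin /Z -/y /a.
    have -> : (m_ l)%:R `^ eta = ((m_ l)%:R `^ (- (eta / 2))) ^- 2 :> R.
      rewrite powRN exprVn invrK -powR_mulrn ?powR_ge0// -powRrM.
      by congr (_ `^ _); field.
    rewrite -{1}(sqr_sqrtr (sigma2_ge0 y)).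
    have a0 := a_gt0 l; rewrite /a in a0.
    have g0 : 0 < `|inner_mean psi y - c| by rewrite normr_gt0 subr_eq0.
    rewrite le_eqVlt; apply/orP; left; apply/eqP.
    move: (`|_|) (Num.sqrt _) (_ `^ _) g0 s0 a0 => g s b g0 s0 b0.
    by field; rewrite !gt_eqF.
have sqE l : ('E_Pr[fun t => ((P_ l t - P t) ^+ 2)%R] = Pr (A l))%E.
  rewrite expectation_sqr_indicB; [|exact: mltc..].
  by congr (Pr _); apply/seteqP; split=> t /=; rewrite !mem_setE.
split=> [l|].
  apply: variance_le_second_moment; apply: (@Lfun2_bounded _ _ _ _ _ 1).
    by apply: measurable_funB; apply: measurable_indic; exact: mltc.
  move=> t; rewrite /P_ /P !indicE.
  by case: (_ \in _); case: (_ \in _);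
    rewrite ?subrr ?subr0 ?sub0r ?normrN ?normr0 ?normr1.
apply/eqO_exP; exists (6 * C); first by rewrite mulr_gt0.
apply: nearW => l.
have mA : measurable (A l).
  by apply: measurable_neq_bool; apply: measurable_fun_ltr => //;
    exact: measurable_cst.
rewrite sqE /= (ger0_norm (fine_ge0 _))// ger0_norm ?powR_ge0//.
by rewrite -lee_fin fineK ?fin_num_measure.
Qed.
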